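(* Let $X$ be a Banach space such that the class $\ast\ast(X^{f})$ is superreflexive. Let $E_{X}$ be the corresponding separable space of almost universal disposition, i.e. a separable Banach space $E_X\in\ast\ast(X^{f})$ that is of almost universal disposition with respect to $\mathfrak{M}(\ast\ast(X^{f}))$. Then $E_{X}$ is a norm one complemented subspace (i.e. the range of a norm one linear projection) of any space $Z$ from the class $\ast\ast(X^{f})$ that contains $E_X$ as a subspace.
   Context: Finite representability: $X<_{f}Y$ means that for each $\varepsilon>0$ and each finite dimensional subspace $A$ of $X$ there are a subspace $B$ of $Y$ and an isomorphism $u:A\to B$ with $\|u\|\|u^{-1}\|\le 1+\varepsilon$. $X\sim_f Y$ (finitely equivalent) means $X<_fY$ and $Y<_fX$. $X^{f}$ is the class of all Banach spaces $Y$ with $Y\sim_f X$. A class $X^f$ is superreflexive if every space in it is reflexive. Minkowski space: $\mathfrak{M}_n$ is the set of (isometry classes of) $n$-dimensional Banach spaces with the metric $\log d$, $d$ the Banach-Mazur distance; $\mathfrak{M}$ is the disjoint union of the $\mathfrak{M}_n$ over all finite dimensions $n$. For a Banach space $X$, $H(X)\subseteq\mathfrak{M}$ is the set of its finite dimensional subspaces (isometric ones identified), and $\mathfrak{M}(X^{f})=\overline{H(X)}$ (closure in $\mathfrak{M}$), which depends only on the class $X^f$ and determines it. For $K\subseteq\mathfrak{M}$: $H(K)$ is the set of all subspaces of members of $K$; $Q(K)$ is the set of all quotient spaces $B/F$ of members $B\in K$ by subspaces $F$; $HQ(K)=H(Q(K))$. $l_2(X)$ is the $l_2$-sum of countably many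 copies of $X$, and $\mathsf{D}_2(X^f)=(l_2(X))^f$. The class $\ast\ast(X^{f})$ is the class $W^{f}$ determined by $\mathfrak{M}(W^{f})=HQ\,\mathfrak{M}(\mathsf{D}_2(X^{f}))$. Almost universal disposition: a Banach space $E$ is of almost universal disposition with respect to a class $\mathcal{K}$ of Banach spaces if for every $A,B\in\mathcal{K}$ with $A$ a subspace of $B$, every $\varepsilon>0$ and every isomorphic embedding $i:A\to E$ there is an isomorphic embedding $\hat\imath:B\to E$ with $\hat\imath|_A=i$ and $\|\hat\imath\|\|\hat\imath^{-1}\|\le(1+\varepsilon)\|i\|\|i^{-1}\|$ (inverses are taken on the ranges). *)

(* Defs.v *)
(* Banach spaces are real: completeNormedModType R with R : realType. *)
From HB Require Import structures.
From mathcomp Require Import all_boot all_order all_algebra.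
From mathcomp Require Import all_classical all_reals all_analysis.
From mathcomp Require Import ring lra.

Set Implicit Arguments.
Unset Strict Implicit.
Unset Printing Implicit Defensive.

Import Order.TTheory GRing.Theory Num.Theory.
Import numFieldNormedType.Exports.

Local Open Scope classical_set_scope.
Local Open Scope ring_scope.

Section l2_sequences.
Context {R : realType} {X : normedModType R}.
Implicit Types (x y : nat -> X) (A B C : R).

Definition sqsum x : R^nat := series (fun n => `|x n| ^+ 2).

Definition l2_pred : {pred nat -> X} := [pred x | `[< cvgn (sqsum x) >]].

Lemma sqsum_nd x : nondecreasing_seq (sqsum x).
Proof. by apply: nondecreasing_series => n _ _; exact: sqr_ge0. Qed.

Lemma sqsum_ge0 x n : 0 <= sqsum x n.
Proof. by apply: sumr_ge0 => i _; exact: sqr_ge0. Qed.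

Lemma sqsum_bounded x C : (forall n, sqsum x n <= C) ->
  cvgn (sqsum x) /\ limn (sqsum x) <= C.
Proof.
move=> h; have cx : cvgn (sqsum x).
  apply: nondecreasing_is_cvgn; first exact: sqsum_nd.
  by exists C => _ [n _ <-].
by split=> //; apply: limr_le => //; near=> n; exact: h.
Unshelve. all: by end_near. Qed.

Lemma sqsum_le_lim x n : cvgn (sqsum x) -> sqsum x n <= limn (sqsum x).
Proof. by move=> cx; apply: nondecreasing_cvgn_le => //; exact: sqsum_nd. Qed.

Lemma sqsum_lim_ge0 x : cvgn (sqsum x) -> 0 <= limn (sqsum x).
Proof. by move=> cx; exact: le_trans (sqsum_ge0 x 0) (sqsum_le_lim 0 cx). Qed.

Lemma sqsumD x y A B n : 0 <= A -> 0 <= B ->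
  sqsum x n <= A ^+ 2 -> sqsum y n <= B ^+ 2 ->
  sqsum (x + y) n <= (A + B) ^+ 2.
Proof.
move=> A0 B0 hx hy; apply/ler_addgt0Pr => e e0.
have key (P Q : R) : 0 < P -> 0 < Q -> sqsum x n <= P ^+ 2 ->
    sqsum y n <= Q ^+ 2 -> sqsum (x + y) n <= (P + Q) ^+ 2.
  move=> P0 Q0 hP hQ.
  have -> : (P + Q) ^+ 2 = (1 + Q / P) * P ^+ 2 + (1 + P / Q) * Q ^+ 2.
    by field; rewrite !gt_eqF.
  apply: (@le_trans _ _ ((1 + Q / P) * sqsum x n + (1 + P / Q) * sqsum y n)).
    rewrite /sqsum /series /= !mulr_sumr -big_split /=.
    apply: ler_sum => i _; rewrite addrfctE.
    apply: (@le_trans _ _ ((`|x i| + `|y i|) ^+ 2)).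
      by rewrite lerXn2r ?nnegrE ?addr_ge0 ?ler_normD.
    set a := `|x i|; set b := `|y i|; rewrite -subr_ge0.
    have -> : (1 + Q / P) * a ^+ 2 + (1 + P / Q) * b ^+ 2 - (a + b) ^+ 2
              = (Q * a - P * b) ^+ 2 / (P * Q).
      by field; rewrite !gt_eqF.
    by rewrite mulr_ge0 ?sqr_ge0// invr_ge0 mulr_ge0 ?ltW.
  by apply: lerD; apply: ler_wpM2l => //; rewrite addr_ge0// divr_ge0 ?ltW.
pose D := 4 * (A + B + 1).
have D0 : 0 < D by rewrite /D; lra.
pose d := Num.min 1 (e / D).
have d0 : 0 < d by rewrite /d lt_min ltr01 divr_gt0.
have d1 : d <= 1 by rewrite /d ge_min lexx.
have dD : d * D <= e.
  by rewrite -ler_pdivlMr// /d ge_min lexx orbT.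
apply: (le_trans (key (A + d) (B + d) _ _ _ _)).
- by rewrite ltr_wpDl.
- by rewrite ltr_wpDl.
- by apply: (le_trans hx); rewrite lerXn2r ?nnegrE ?addr_ge0 ?lerDl ?(ltW d0)//.
- by apply: (le_trans hy); rewrite lerXn2r ?nnegrE ?addr_ge0 ?lerDl ?(ltW d0)//.
have : d * d <= d by rewrite ler_piMr// ltW.
move: dD; rewrite /D => dD dd; nra.
Qed.

Lemma sqsumZ (a : R) x n : sqsum (a *: x) n = `|a| ^+ 2 * sqsum x n.
Proof.
rewrite /sqsum /series /= mulr_sumr; apply: eq_bigr => i _.
by rewrite normrZ exprMn.
Qed.

Lemma l2_submod_closed : submod_closed l2_pred.
Proof.
split=> [|a x y /asboolP cx /asboolP cy]; apply/asboolP.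
  suff h n : sqsum (0 : nat -> X) n <= 0 by exact: (sqsum_bounded h).1.
  by rewrite /sqsum /series /= big1// => i _; rewrite normr0 expr0n.
have cax n : sqsum (a *: x) n <= (`|a| * Num.sqrt (limn (sqsum x))) ^+ 2.
  rewrite sqsumZ exprMn ler_wpM2l ?sqr_ge0// sqr_sqrtr ?sqsum_le_lim//.
  exact: sqsum_lim_ge0.
have cy' n : sqsum y n <= (Num.sqrt (limn (sqsum y))) ^+ 2.
  rewrite sqr_sqrtr ?sqsum_le_lim//.
  exact: sqsum_lim_ge0.
have ax0 : 0 <= `|a| * Num.sqrt (limn (sqsum x)).
  by rewrite mulr_ge0// sqrtr_ge0.
have y0 := sqrtr_ge0 (limn (sqsum y)).
exact: (sqsum_bounded (fun n => sqsumD ax0 y0 (cax n) (cy' n))).1.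
Qed.

HB.instance Definition _ :=
  GRing.isSubmodClosed.Build R (nat -> X) l2_pred l2_submod_closed.

End l2_sequences.

Record l2sum (R : realType) (X : normedModType R) :=
  L2sum { l2seq :> nat -> X; _ : l2seq \in l2_pred }.

Section l2_sum.
Context {R : realType} {X : normedModType R}.
Local Notation L := (l2sum X).

HB.instance Definition _ := [isSub for @l2seq R X].
HB.instance Definition _ := [Choice of L by <:].
HB.instance Definition _ := [SubChoice_isSubLmodule of L by <:].

Lemma l2P (x : L) : cvgn (sqsum x).
Proof. by case: x => x /= /asboolP. Qed.
Arguments l2P : clear implicits.

Definition l2norm (x : L) : R := Num.sqrt (limn (sqsum x)).

Lemma l2lim_ge0 (x : L) : 0 <= limn (sqsum x).
Proof. exact: sqsum_lim_ge0 (l2P x). Qed.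

Lemma l2norm_leP (x : L) (C : R) : 0 <= C ->
  (l2norm x <= C) <-> (forall n, sqsum x n <= C ^+ 2).
Proof.
move=> C0; split=> [h n|h].
  apply: (le_trans (sqsum_le_lim n (l2P x))).
  rewrite -[leLHS]sqr_sqrtr ?l2lim_ge0//.
  by rewrite lerXn2r ?nnegrE ?sqrtr_ge0.
rewrite -(ger0_norm C0) -sqrtr_sqr; apply: ler_wsqrtr.
exact: (sqsum_bounded h).2.
Qed.

Lemma l2norm_ge0 (x : L) : 0 <= l2norm x.
Proof. exact: sqrtr_ge0. Qed.

Lemma l2normD (x y : L) : l2norm (x + y) <= l2norm x + l2norm y.
Proof.
apply/l2norm_leP => [|n]; first by rewrite addr_ge0 ?l2norm_ge0.
apply: (@sqsumD _ _ x y); rewrite ?l2norm_ge0//.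
- by have /l2norm_leP := lexx (l2norm x); apply; exact: l2norm_ge0.
- by have /l2norm_leP := lexx (l2norm y); apply; exact: l2norm_ge0.
Qed.

Lemma l2normZ (a : R) (x : L) : l2norm (a *: x) = `|a| * l2norm x.
Proof.
rewrite /l2norm.
have -> : sqsum (a *: x : L) = (fun n => `|a| ^+ 2 * sqsum x n).
  by apply/funext => n; rewrite -sqsumZ.
rewrite (_ : limn _ = `|a| ^+ 2 * limn (sqsum x)).
  by rewrite sqrtrM ?sqr_ge0// sqrtr_sqr normr_id.
by apply/cvg_lim => //; apply: cvgMr; exact: l2P.
Qed.

Lemma l2norm_coord (x : L) n : `|x n| <= l2norm x.
Proof.
have /l2norm_leP := lexx (l2norm x).
move=> /(_ (l2norm_ge0 x) n.+1) h.
rewrite -(@ler_pXn2r _ 2)// ?nnegrE ?l2norm_ge0//.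
apply: le_trans h; rewrite /sqsum /series /= big_nat_recr//=.
by rewrite lerDr sumr_ge0// => i _; exact: sqr_ge0.
Qed.

Lemma l2norm_eq0 (x : L) : l2norm x = 0 -> x = 0.
Proof.
move=> x0; apply/val_inj/funext => n /=; apply/eqP.
by rewrite -normr_le0 -x0 l2norm_coord.
Qed.

HB.instance Definition _ := Lmodule_isNormed.Build R L l2normD l2normZ l2norm_eq0.

End l2_sum.

Section l2_complete.
Context {R : realType} {X : completeNormedModType R}.
Local Notation L := (l2sum X).

Lemma l2_complete (F : set_system L) : ProperFilter F -> cauchy F -> cvg F.
Proof.
move=> FF /cauchy_ballP cF.
have near_diff (e : R) : 0 < e -> \forall x & y \near F, l2norm (x - y) < e.
  by move=> e0; exact: cF e e0.
pose co n : L -> X := fun x => x n.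
have cvgco n : cvg (co n @ F).
  apply: cauchy_cvg; apply/cauchy_ballP => e e0.
  rewrite near_map2; apply: filterS (near_diff e e0) => -[x y] /=.
  by rewrite -ball_normE /=; exact: le_lt_trans (l2norm_coord (x - y) n).
pose y n := lim (co n @ F).
have key (e : R) : 0 < e ->
    \forall x \near F, forall n, sqsum (l2seq x - y) n <= e ^+ 2.
  move=> e0; apply: filterS (nearP_dep (near_diff e e0)) => x Fx n.
  have cvgs : (fun z : L => sqsum (x - z : L) n) @ F -->
              sqsum (l2seq x - y) n.
    rewrite /sqsum /series /=.
    apply: cvg_big => [|i _]; first exact: add_continuous.
    have cd : (fun z : L => `|x i - z i|) @ F --> `|x i - y i|.
      by apply: cvg_norm; apply: cvgB; [exact: cvg_cst|exact: cvgco].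
    by rewrite expr2; under eq_fun do rewrite expr2; exact: cvgM.
  rewrite -(cvg_lim _ cvgs)//; apply: limr_le; first by apply/cvg_ex; eexists; exact: cvgs.
  near=> z.
  have : l2norm (x - z) <= e by apply/ltW; near: z.
  by move=> /(l2norm_leP _ (ltW e0)).
have [x0 hx0] : exists x0 : L, forall n, sqsum (l2seq x0 - y) n <= 1 ^+ 2.
  by have /filter_ex := key 1 ltr01.
have yP : y \in l2_pred.
  have dP : l2seq x0 - y \in l2_pred by apply/asboolP; exact: (sqsum_bounded hx0).1.
  have -> : y = (x0 : nat -> X) - (l2seq x0 - y) by rewrite opprB addrC subrK.
  by apply: rpredB => //; exact: valP.
apply/cvg_ex; exists (L2sum yP); apply/cvgrPdist_le => e e0.
apply: filterS (key e e0) => x hx.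
rewrite distrC.
by apply/(l2norm_leP (x - L2sum yP) (ltW e0)).
Unshelve. all: by end_near. Qed.

HB.instance Definition _ := Uniform_isComplete.Build L l2_complete.

End l2_complete.

Section operators.
Context {R : realType}.
Implicit Types V W : normedModType R.

Definition opnorm V W (f : V -> W) : R :=
  sup [set `|f x| | x in [set x | `|x| <= 1]].

(* Norm of the inverse of an injective f, taken on the range of f: the unit
   ball of range f is the set of f x with `|f x| <= 1. *)
Definition inv_opnorm V W (f : V -> W) : R :=
  sup [set `|x| | x in [set x | `|f x| <= 1]].

(* Linear, continuous, with continuous inverse on the range. *)
Definition iso_embedding V W (f : {linear V -> W}) : Prop :=
  continuous f /\ exists2 c : R, 0 < c & forall x, c * `|x| <= `|f x|.

Definition isometric V W (f : {linear V -> W}) : Prop :=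
  forall x, `|f x| = `|x|.

(* Spaces are identified up to isometry, so a subspace is the domain of a
   linear isometric embedding. *)
Definition subspace_of W V : Prop := exists j : {linear W -> V}, isometric j.

(* W is isometric to V / F, where F is the kernel of q and V / F carries the
   norm `|x + F| = inf `|x - f| over f in F. *)
Definition quotient_of W V : Prop := exists q : {linear V -> W},
  range q = setT /\
  forall x, `|q x| = inf [set `|x - f| | f in [set f | q f = 0]].

Definition separable V : Prop := exists2 D : set V, countable D & dense D.

Definition dual V : set (V -> R^o) := [set f | linear f /\ continuous f].

(* The canonical embedding of V in its bidual is onto; elements of the bidual
   are functions Phi considered on dual V only. *)
Definition reflexive_space V : Prop := forall Phi : (V -> R^o) -> R,
  (forall (a : R) f g, dual f -> dual g ->
     Phi (a *: f + g) = a * Phi f + Phi g) ->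
  (exists C : R, forall f, dual f -> `|Phi f| <= C * opnorm f) ->
  exists x : V, forall f, dual f -> Phi f = f x.

End operators.

Section local_theory.
Context {R : realType}.
Implicit Types (A B V W : normedModType R) (X Y E Z : completeNormedModType R)
  (K : normedModType R -> Prop).

Definition has_dim (n : nat) V : Prop :=
  exists f : {linear 'rV[R]_n -> V}, bijective f.

(* The zero space is left out: its operators have norm 0, so that a bound by
   opnorm i * inv_opnorm i would fail for any nonzero extension of i. *)
Definition fin_dim V : Prop := exists2 n, (0 < n)%N & has_dim n V.

Definition banach_mazur V W : R :=
  inf [set opnorm u * inv_opnorm u |
       u in [set u : {linear V -> W} | iso_embedding u /\ range u = setT]].

(* Closure for the metric ln d; spaces of different dimensions lie in different
   components. *)
Definition minkowski_closure K V : Prop :=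
  exists2 n, (0 < n)%N & has_dim n V /\
  forall e : R, 0 < e ->
    exists A, [/\ has_dim n A, K A & ln (banach_mazur A V) < e].

Definition Hsubspaces K A : Prop :=
  fin_dim A /\ exists2 B, K B & subspace_of A B.

Definition Qquotients K A : Prop :=
  fin_dim A /\ exists2 B, K B & quotient_of A B.

Definition fd_subspaces V A : Prop :=
  fin_dim A /\ subspace_of A V.

(* The family M(X^f), computed from the representative X. *)
Definition minkowski_set V : normedModType R -> Prop :=
  minkowski_closure (fd_subspaces V).

Definition fin_representable X Y : Prop := forall (e : R) A, 0 < e ->
  fd_subspaces X A -> exists u : {linear A -> Y},
    iso_embedding u /\ opnorm u * inv_opnorm u <= 1 + e.

Definition fin_equivalent X Y : Prop :=
  fin_representable X Y /\ fin_representable Y X.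

(* X^f *)
Definition fclass X Y : Prop := fin_equivalent Y X.

Definition superreflexive (C : completeNormedModType R -> Prop) : Prop :=
  forall Y, C Y -> reflexive_space Y.

(* M( **(X^f)) = HQ M(D_2(X^f)), where D_2(X^f) = (l2sum X)^f. *)
Definition starstar_minkowski X : normedModType R -> Prop :=
  Hsubspaces (Qquotients (minkowski_set (l2sum X))).

(* **(X^f): the class W^f with M(W^f) = HQ M(D_2(X^f)). *)
Definition starstar X Y : Prop :=
  exists W : completeNormedModType R,
    (forall A, minkowski_set W A <-> starstar_minkowski X A) /\ fclass W Y.

Definition almost_universal_disposition E K : Prop :=
  forall A B, K A -> K B -> forall j : {linear A -> B}, isometric j ->
  forall e : R, 0 < e -> forall i : {linear A -> E}, iso_embedding i ->
  exists i' : {linear B -> E}, [/\ iso_embedding i',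
    forall a, i' (j a) = i a &
    opnorm i' * inv_opnorm i' <= (1 + e) * (opnorm i * inv_opnorm i)].

(* The range of j is the range of a continuous linear projection of norm one;
   a projection onto the zero space has norm 0, hence the proviso. *)
Definition norm_one_complemented E Z (j : {linear E -> Z}) : Prop :=
  exists P : {linear Z -> Z}, [/\ continuous P, forall z, P (P z) = P z,
    range P = range j & (exists x : E, x != 0) -> opnorm P = 1].

End local_theory.

(* Main.v *)
(* Every finite dimensional subspace of E or Z lies in the family for which E is
   of almost universal disposition, so, given finite dimensional A in E and B in
   Z with j(A) in B, the inclusion of A in E extends to an operator from B to E
   of norm at most 1 + e. Along an ultrafilter on maps from Z to E refining the
   directed system of these local extensions, the values at each z are bounded
   and thus converge weakly, E being reflexive; the weak limit is a linear
   contraction from Z to E that inverts j. *)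

Require Import Defs.
From HB Require Import structures.
From mathcomp Require Import all_boot all_order all_algebra.
From mathcomp Require Import all_classical all_reals all_analysis.
From mathcomp Require Import ring lra.

Set Implicit Arguments.
Unset Strict Implicit.
Unset Printing Implicit Defensive.

Import Order.TTheory GRing.Theory Num.Theory.
Import numFieldNormedType.Exports.

Local Open Scope classical_set_scope.
Local Open Scope ring_scope.

(** * Hahn-Banach: functionals norming a given vector *)

Section norming_functional.
Context {R : realType} {V : normedModType R}.
Implicit Types (x z : V) (u v : V * R) (G : set (V * R)).

(* Graphs of functionals dominated by the norm; single-valuedness follows from
   the domination. *)
Let dominated x0 G := [/\ forall a u v, G u -> G v ->
    G (a *: u.1 + v.1, a * u.2 + v.2),
  forall u, G u -> u.2 <= `|u.1| & forall u, G u -> G (x0, `|x0|)].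

(** A value [c] at [z] is admissible when [u.2 - |u.1 - z| <= c <= |v.1 + z| - v.2] for all [u], [v]
    in [G]. The triangle inequality puts every left side below every right side, so the supremum of
    the left sides serves; homogeneity carries the bound to all multiples of [z]. *)
Let one_step x0 G z : dominated x0 G -> G (x0, `|x0|) ->
  exists c G', [/\ dominated x0 G', G `<=` G' & G' (z, c)].
Proof.
move=> [Glin Gle _] Gx0.
have G0 : G (0, 0).
  have := Glin (-1) _ _ Gx0 Gx0.
  by rewrite /= scaleN1r addNr mulN1r addNr.
have Gscale a u : G u -> G (a *: u.1, a * u.2).
  by move=> Gu; have := Glin a _ _ Gu G0; rewrite /= !addr0.
pose S := [set u.2 - `|u.1 - z| | u in G].
have Sub u : G u -> ubound S (`|u.1 + z| - u.2).
  move=> Gu _ [v Gv <-]; have /Gle/= := Glin 1 _ _ Gu Gv.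
  rewrite scale1r mul1r => h.
  have := ler_normD (u.1 + z) (v.1 - z); rewrite addrACA subrr addr0 => h'.
  lra.
have supS : has_sup S.
  by split; [exists (0 - `|0 - z|), (0, 0)|
             exists (`|0 + z| - 0); exact: (Sub _ G0)].
pose c := sup S.
have cge u : G u -> u.2 - `|u.1 - z| <= c.
  by move=> Gu; apply: ub_le_sup; [exact: supS.2|exists u].
have cle u : G u -> c <= `|u.1 + z| - u.2.
  by move=> Gu; apply: ge_sup; [exact: supS.1|exact: Sub].
exists c, [set u | exists2 v, G v & exists t, u = (v.1 + t *: z, v.2 + t * c)].
split; [split| |].
- move=> a _ _ [v Gv [t ->]] [v' Gv' [t' ->]] /=.
  exists (a *: v.1 + v'.1, a * v.2 + v'.2); first exact: Glin.
  exists (a * t + t') => /=; congr (_, _); last by ring.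
  by rewrite scalerDr scalerA scalerDl addrACA.
- move=> _ [v Gv [t ->]] /=.
  (* For [t < 0] the lower bound on [c] is applied to [v] divided by [- t], for [t > 0] the upper
     bound to [v] divided by [t]. *)
  have [t0|t0|->] := ltgtP t 0; last by rewrite scale0r mul0r !addr0; exact: Gle.
  + have s0 : 0 < - t by rewrite oppr_gt0.
    have /cge/= := Gscale (- t)^-1 _ Gv.
    rewrite -(ler_pM2l s0) mulrBr mulVKf ?gt_eqF//.
    rewrite -{1}(gtr0_norm s0) -normrZ scalerBr scalerA divff ?gt_eqF//.
    by rewrite scale1r scaleNr opprK => h; lra.
  + have /cle/= := Gscale t^-1 _ Gv.
    rewrite -(ler_pM2l t0) mulrBr mulVKf ?gt_eqF//.
    rewrite -{2}(gtr0_norm t0) -normrZ scalerDr scalerA divff ?gt_eqF//.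
    by rewrite scale1r => h; lra.
- move=> _ _; exists (x0, `|x0|) => //; exists 0.
  by rewrite scale0r mul0r !addr0.
- by move=> [v r] Gv; exists (v, r) => //; exists 0; rewrite scale0r mul0r !addr0.
- by exists (0, 0) => //; exists 1; rewrite /= scale1r mul1r !add0r.
Qed.

Lemma norming_functional x0 : exists f : V -> R^o,
  [/\ linear f, forall x, `|f x| <= `|x| & f x0 = `|x0|].
Proof.
(* The last clause of [dominated] is conditional so that the union of the empty chain, the empty
   graph, satisfies it. A maximal graph is nonempty nevertheless, since the line through
   [(x0, |x0|)] properly contains the empty one. *)
have [|A [domA maxA]] := @Zorn_bigcup _ (dominated x0).
  move=> F FP Ftot; split.
  - move=> a u v [X FX Xu] [Y FY Yv]; have [XY|YX] := Ftot _ _ FX FY.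
      by exists Y => //; have [+ _ _] := FP _ FY; apply => //; exact: XY.
    by exists X => //; have [+ _ _] := FP _ FX; apply => //; exact: YX.
  - by move=> u [X /FP[_ + _]]; exact.
  - by move=> u [X FX Xu]; exists X => //; have [_ _] := FP _ FX; apply; exact: Xu.
have Ax0 : A (x0, `|x0|).
  apply: contrapT => nA; have A0 : A = set0.
    by apply/seteqP; split=> // u; have [_ _ h] := domA => /h.
  apply: (maxA [set u | exists t, u = (t *: x0, t * `|x0|)]).
    rewrite A0; split=> [//|/(_ (x0, `|x0|))]; apply.
    by exists 1; rewrite scale1r mul1r.
  split.
  - move=> a _ _ [t ->] [t' ->] /=; exists (a * t + t').
    by rewrite scalerDl scalerA mulrDl mulrA.
  - by move=> _ [t ->] /=; rewrite normrZ ler_wpM2r// ler_norm.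
  - by move=> _ _; exists 1; rewrite scale1r mul1r.
have Atot x : exists r, A (x, r).
  have [c [G' [domG' AG' G'x]]] := one_step x domA Ax0.
  exists c; apply: contrapT => nA; apply: (maxA G') => //.
  by split=> // /(_ (x, c)); tauto.
have [Alin Ale _] := domA.
have [f fA] := choice Atot.
have Afun x r : A (x, r) -> r = f x.
  move=> Ar; have Af := fA x.
  have /Ale/= := Alin (-1) _ _ Ar Af; have /Ale/= := Alin (-1) _ _ Af Ar.
  by rewrite scaleN1r addNr normr0 !mulN1r => h1 h2; apply/eqP; rewrite eq_le; lra.
have flin : linear (f : V -> R^o).
  by move=> a x y; rewrite -(Afun _ _ (Alin a _ _ (fA x) (fA y))).
exists f; split=> //; last by rewrite -(Afun _ _ Ax0).
move=> x; rewrite ler_norml (Ale _ (fA x)) andbT lerNl.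
have -> : - f x = f (- x); last by rewrite -(normrN x); exact: Ale (fA _).
have f0 : f 0 = 0.
  by have := flin (-1) x x; rewrite !scaleN1r !addNr.
by have := flin (-1) x 0; rewrite !addr0 f0 !scaleN1r addr0.
Qed.

End norming_functional.

(** * Norms pulled back along injective linear maps *)

Section pullback.
Context {R : realType} {V : lmodType R} {W : normedModType R}.

(** The injectivity proof is a parameter of the alias because definiteness of the attached norm
    rests on it. *)
Definition pullback (g : {linear V -> W}) & injective g : Type := V.

Context (g : {linear V -> W}) (ginj : injective g).

HB.instance Definition _ := GRing.Lmodule.copy (pullback ginj) V.

Let pullback_norm (x : pullback ginj) : R := `|g x|.

Let pullback_normD x y :
  pullback_norm (x + y) <= pullback_norm x + pullback_norm y.
Proof. by rewrite /pullback_norm linearD ler_normD. Qed.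

Let pullback_normZ (a : R) x : pullback_norm (a *: x) = `|a| * pullback_norm x.
Proof. by rewrite /pullback_norm linearZ normrZ. Qed.

Let pullback_norm0 x : pullback_norm x = 0 -> x = 0.
Proof.
move=> /eqP; rewrite normr_eq0 => /eqP gx0; apply: ginj.
by rewrite gx0 linear0.
Qed.

HB.instance Definition _ := Lmodule_isNormed.Build R (pullback ginj)
  pullback_normD pullback_normZ pullback_norm0.

Lemma pullback_normE (x : pullback ginj) : `|x| = `|g x|.
Proof. by []. Qed.

End pullback.

Lemma linear_ofP (R : pzRingType) (U : lmodType R) (V : lmodType R)
  (f : U -> V) : linear f -> exists g : {linear U -> V}, g =1 f.
Proof.
move=> lf; pose m := GRing.isLinear.Build R U V _ f lf.
by exists (HB.pack_for {linear U -> V} f m).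
Qed.

(** * Bounds on operators and on their inverses *)

Section operator_norm.
Context {R : realType} {V W : normedModType R}.
Implicit Type f : {linear V -> W}.

Lemma linear_continuousP f :
  continuous f <-> exists2 C : R, 0 < C & forall x, `|f x| <= C * `|x|.
Proof.
rewrite -linear_bounded_continuous linear_boundedP; split.
  by move=> /pinfty_ex_gt0.
move=> [C C0 fC]; near=> r => x; apply: le_trans (fC x) _.
by rewrite ler_wpM2r//; near: r; exact: nbhs_pinfty_ge.
Unshelve. all: by end_near. Qed.

Lemma opnorm_le (f : V -> W) (C : R) : f 0 = 0 -> 0 <= C ->
  (forall x, `|f x| <= C * `|x|) -> opnorm f <= C.
Proof.
move=> f0 C0 fC; apply: ge_sup; first by exists `|f 0|, 0; rewrite //= normr0.
move=> _ [x /= x1 <-]; apply: le_trans (fC x) _.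
by rewrite ler_piMr.
Qed.

Lemma opnorm_ub f : continuous f ->
  has_ubound [set `|f x| | x in [set x | `|x| <= 1]].
Proof.
move=> /linear_continuousP[C C0 fC]; exists C => _ [x /= x1 <-].
by apply: le_trans (fC x) _; rewrite ler_piMr// ltW.
Qed.

Lemma opnorm_ge0 f : continuous f -> 0 <= opnorm f.
Proof.
move=> cf; apply: ub_le_sup; first exact: opnorm_ub.
by exists 0; rewrite /= ?linear0 ?normr0.
Qed.

Lemma le_opnorm f x : continuous f -> `|f x| <= opnorm f * `|x|.
Proof.
move=> cf; have [->|x0] := eqVneq x 0; first by rewrite linear0 !normr0 mulr0.
rewrite -ler_pdivrMr ?normr_gt0//.
have -> : `|f x| / `|x| = `|f (`|x|^-1 *: x)|.
  by rewrite linearZ normrZ normfV normr_id mulrC.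
apply: ub_le_sup; first exact: opnorm_ub.
by exists (`|x|^-1 *: x) => //=; rewrite normrZ normfV normr_id mulVf// normr_eq0.
Qed.

Lemma inv_opnorm_ub f : iso_embedding f ->
  has_ubound [set `|x| | x in [set x | `|f x| <= 1]].
Proof.
move=> [_ [c c0 fc]]; exists c^-1 => _ [x /= fx <-].
by rewrite -[leRHS]mulr1 ler_pdivlMl//; exact: le_trans (fc x) fx.
Qed.

Lemma inv_opnorm_ge0 f : iso_embedding f -> 0 <= inv_opnorm f.
Proof.
move=> fi; apply: ub_le_sup; first exact: inv_opnorm_ub.
by exists 0; rewrite /= ?linear0 normr0.
Qed.

Lemma isometric_iso_embedding f : isometric f -> iso_embedding f.
Proof.
move=> fi; split; last by exists 1 => // x; rewrite mul1r fi.
by apply/linear_continuousP; exists 1 => // x; rewrite mul1r fi.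
Qed.

Lemma isometric_opnorm_le1 f : isometric f -> opnorm f <= 1.
Proof. by move=> fi; apply: opnorm_le; rewrite ?linear0// => x; rewrite fi mul1r. Qed.

Lemma isometric_inv_opnorm_le1 f : isometric f -> inv_opnorm f <= 1.
Proof.
move=> fi; apply: ge_sup; first by exists 0, 0; rewrite /= ?linear0 normr0.
by move=> _ [x /= + <-]; rewrite fi.
Qed.

End operator_norm.

Lemma isometric_inj (R : realType) (V W : normedModType R)
  (f : {linear V -> W}) : isometric f -> injective f.
Proof.
move=> fi; apply: raddf_inj => x fx0; apply/eqP.
by rewrite -normr_eq0 -fi fx0 normr0.
Qed.

Lemma iso_embedding_inj (R : realType) (V W : normedModType R)
  (f : {linear V -> W}) : iso_embedding f -> injective f.
Proof.
move=> [_ [c c0 fc]]; apply: raddf_inj => x fx0; apply/eqP.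
rewrite -normr_le0 -(pmulr_rle0 _ c0); apply: le_trans (fc x) _.
by rewrite fx0 normr0.
Qed.

(** * Finite dimensional subspaces of members of the class *)

Section local_structure.
Context {R : realType}.
Implicit Types (A B : normedModType R) (X Y Z : completeNormedModType R).

(* The image of A in Y under an almost isometric embedding u is A itself with
   the norm pulled back along u. *)
Lemma fin_representable_minkowski Y Z A : fin_representable Z Y ->
  fd_subspaces Z A -> minkowski_set Y A.
Proof.
move=> ZY [[n n0 An] AZ]; exists n => //; split=> // e e0.
have [|u [ui uE]] := ZY e A e0; first by split=> //; exists n.
have uinj := iso_embedding_inj ui.
have [cu [c c0 uc]] := ui.
have [f fbij] := An.
pose A' : normedModType R := pullback uinj.
have A'n : has_dim n A' by exists (f : {linear 'rV[R]_n -> A'}).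
exists A'; split=> //.
  by split; [exists n|exists (u : {linear A' -> Y})].
pose k : {linear A' -> A} := @idfun A.
have ki : iso_embedding k.
  split.
    apply/linear_continuousP; exists c^-1; first by rewrite invr_gt0.
    by move=> x; rewrite ler_pdivlMl//; exact: uc.
  have /linear_continuousP[C C0 uC] := cu.
  exists C^-1; first by rewrite invr_gt0.
  by move=> x; rewrite ler_pdivrMl//; exact: uC.
have bm1 : banach_mazur A' A <= 1 + e.
  (* Since [|x|] in [A'] is [|u x|], the numbers [opnorm k] and [inv_opnorm k] are [inv_opnorm u]
     and [opnorm u]; hence the swap of factors. *)
  apply: le_trans uE; rewrite mulrC; apply: ge_inf; last first.
    exists k => //; split=> //; rewrite -subTset => x _.
    by exists x.
  exists 0 => _ [h [hi _] <-].
  by rewrite mulr_ge0 ?inv_opnorm_ge0// opnorm_ge0//; case: hi.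
(* At nonpositive arguments [ln] is 0 by convention; otherwise the strict inequality
   [1 + e < expR e] concludes. *)
have [bm0|bm0] := leP (banach_mazur A' A) 0; first by rewrite ln0.
rewrite -ltr_expR lnK ?posrE//; apply: le_lt_trans bm1 _.
by rewrite expR_gt1Dx// gt_eqF.
Qed.

(** Finite representability in [W] places [A] in the closure that defines [minkowski_set W]. Applied
    to both [E] and [Z], this lets the disposition of [E] act on their finite dimensional
    subspaces. *)
Lemma starstar_fd_subspaces X Y A :
  starstar X Y -> fd_subspaces Y A -> starstar_minkowski X A.
Proof.
by move=> [W [WX [YW _]]] AY; apply/WX; exact: fin_representable_minkowski AY.
Qed.

End local_structure.

(** * Finite spans as injective images of row spaces *)

Section finite_span.
Context {R : realType} {V : lmodType R}.

(** If [x] is not yet in the range, one more coordinate is appended as the coefficient of [x];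
    injectivity survives because a kernel vector with nonzero last coordinate would put [x] in the
    range of [g]. *)
Lemma extend_injective_row n (g : {linear 'rV[R]_n -> V}) (x : V) :
  injective g -> exists m (h : {linear 'rV[R]_m -> V}),
    [/\ injective h, forall v, exists w, h w = g v & exists w, h w = x].
Proof.
move=> ginj; have [[v gv]|nx] := pselect (exists v, g v = x).
  by exists n, g; split=> // [w|]; [exists w|exists v].
have [|h hE] := @linear_ofP R 'rV[R]_(n + 1) V
    (fun v => g (lsubmx v) + rsubmx v 0 0 *: x).
  move=> a u v; rewrite !linearP /= !mxE scalerDl scalerDr scalerA.
  by rewrite [LHS]addrACA.
have h_row v b : h (row_mx v b) = g v + b 0 0 *: x.
  by rewrite hE row_mxKl row_mxKr.
exists (n + 1)%N, h; split.
- apply: raddf_inj => v hv0.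
  have gv0 : g (lsubmx v) = - (rsubmx v 0 0 *: x).
    by apply/eqP; rewrite -addr_eq0 -h_row hsubmxK hv0.
  have b0 : rsubmx v 0 0 = 0.
    apply: contrapT => /eqP b0; apply: nx.
    exists (- (rsubmx v 0 0)^-1 *: lsubmx v).
    by rewrite linearZ /= gv0 scaleNr scalerN opprK scalerA mulVf ?scale1r.
  have l0 : lsubmx v = 0.
    by apply: ginj; rewrite gv0 b0 scale0r oppr0 linear0.
  rewrite -[v]hsubmxK l0 (_ : rsubmx v = 0) ?row_mx0//.
  by apply/rowP => i; rewrite ord1 b0 mxE.
- by move=> v; exists (row_mx v 0); rewrite h_row mxE scale0r addr0.
- by exists (row_mx 0 1%:M); rewrite h_row linear0 mxE add0r scale1r.
Qed.

Lemma extend_injective_rows n (g : {linear 'rV[R]_n -> V}) (t : seq V) :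
  injective g -> exists m (h : {linear 'rV[R]_m -> V}),
    [/\ injective h, forall v, exists w, h w = g v &
        forall x, x \in t -> exists w, h w = x].
Proof.
move=> ginj; elim: t => [|x t [m [h [hinj hg ht]]]].
  by exists n, g; split=> // v; exists v.
have [p [k [kinj kh [w kw]]]] := extend_injective_row x hinj.
exists p, k; split=> // [v|y].
  by have [u <-] := hg v; exact: kh.
rewrite inE => /orP[/eqP ->|/ht[u <-]]; first by exists w.
exact: kh.
Qed.

End finite_span.

(** * Local extensions given by almost universal disposition *)

Section local_projection.
Context {R : realType} {E Z : completeNormedModType R} (j : {linear E -> Z}).

(** The members are arbitrary functions, constrained only through finite lists, so that these sets
    can generate a filter on [Z -> E]. *)
Definition local_projections (s : seq E) (t : seq Z) (e : R) : set (Z -> E) :=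
  [set T : Z -> E |
    [/\ forall a, {in t &, forall x y, T (a *: x + y) = a *: T x + T y},
        {in t, forall z, `|T z| <= (1 + e) * `|z|} &
        {in s, forall x, T (j x) = x}]].

Lemma pullback_fd_subspaces (Y : normedModType R) n
    (g : {linear 'rV[R]_n -> Y}) (ginj : injective g) :
  (0 < n)%N -> fd_subspaces Y (pullback ginj).
Proof.
move=> n0; split; last by exists (g : {linear pullback ginj -> Y}).
exists n => //.
by exists (@idfun 'rV[R]_n : {linear 'rV[R]_n -> pullback ginj}); exists id.
Qed.

Lemma local_projections_nonempty (K : normedModType R -> Prop) s t e :
  isometric j -> (forall A, fd_subspaces E A -> K A) ->
  (forall A, fd_subspaces Z A -> K A) -> almost_universal_disposition E K ->
  (exists x : E, x != 0) -> 0 < e -> local_projections s t e !=set0.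
Proof.
move=> ji KE KZ Eaud [x0 x00] e0.
(* The nonzero [x0] is adjoined to [s] because [fin_dim] excludes the zero space. *)
have [|m [g [ginj _ gs]]] :=
    @extend_injective_rows _ _ 0 (\0 : {linear 'rV[R]_0 -> E}) (x0 :: s).
  by move=> u v _; rewrite [u]thinmx0 [v]thinmx0.
have [a0 ga0] : exists a0, g a0 = x0 by apply: gs; rewrite mem_head.
have m0 : (0 < m)%N.
  case: (m) g a0 ga0 {ginj gs} => // g a0 ga0.
  by move: x00; rewrite -ga0 [a0]thinmx0 linear0 eqxx.
have jinj := isometric_inj ji.
have [|p [h [hinj hg ht]]] :=
    @extend_injective_rows _ _ m (j \o g : {linear 'rV[R]_m -> Z}) t.
  exact: inj_comp.
have [k' k'E] := choice hg.
have [|k kE] := @linear_ofP _ _ _ k'.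
  by move=> a u v; apply: hinj; rewrite linearP !k'E linearP.
have hk v : h (k v) = j (g v) by rewrite kE k'E.
have p0 : (0 < p)%N.
  case: (p) h k {ht hinj hg k' k'E kE} hk => // h k hk.
  have := hk a0; rewrite [k a0]thinmx0 linear0 -(linear0 j) => /jinj/esym.
  by rewrite ga0 => x0E; rewrite x0E eqxx in x00.
pose A : normedModType R := pullback ginj.
pose B : normedModType R := pullback hinj.
have KA : K A by apply: KE; exact: pullback_fd_subspaces.
have KB : K B by apply: KZ; exact: pullback_fd_subspaces.
have ki : isometric (k : {linear A -> B}).
  by move=> v; rewrite !pullback_normE hk ji.
have gi : isometric (g : {linear A -> E}) by [].
have [i [ii ik iE]] := Eaud A B KA KB k ki e e0 g (isometric_iso_embedding gi).
have ci : continuous i by case: ii.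
have i1 : opnorm i <= 1 + e.
  (* Disposition controls only the product of the two norms. As [i] sends the unit vector [k a1] to
     a unit vector, its second factor is at least 1, and the bound passes to [opnorm i]. *)
  have inv1 : 1 <= inv_opnorm i.
    apply: ub_le_sup; first exact: inv_opnorm_ub.
    pose a1 : A := `|x0|^-1 *: a0.
    have na1 : `|g a1| = 1.
      rewrite linearZ normrZ normfV normr_id ga0 mulVf//.
      by rewrite normr_eq0.
    exists (k a1); last by rewrite -na1; exact: (ki a1).
    by rewrite /= ik na1.
  apply: (@le_trans _ _ (opnorm i * inv_opnorm i)).
    by rewrite ler_peMr// opnorm_ge0.
  apply: le_trans iE _; rewrite ler_piMr//; first by rewrite addr_ge0// ltW.
  rewrite -[leRHS]mulr1 ler_pM//.
  - by rewrite opnorm_ge0//; case: (isometric_iso_embedding gi).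
  - by rewrite inv_opnorm_ge0//; exact: isometric_iso_embedding.
  - exact: isometric_opnorm_le1.
  - exact: isometric_inv_opnorm_le1.
(* [r] inverts [h] on its range, which contains [t], its linear combinations and the image of [s];
   the default 0 elsewhere is harmless. *)
have /choice[r rE] (z : Z) : exists v : B, (exists w, h w = z) -> h v = z.
  have [[w hw]|] := pselect (exists w, h w = z); first by exists w.
  by exists 0.
have rh v : r (h v) = v by apply: (hinj); apply: rE; exists v.
exists (i \o r); split=> /=.
- move=> a _ _ /ht[u <-] /ht[v <-] /=.
  by rewrite -linearP !rh linearP.
- move=> _ /ht[u <-]; rewrite rh; apply: le_trans (le_opnorm _ ci) _.
  by rewrite pullback_normE ler_wpM2r.
- move=> x xs; have [|v <-] := gs x; first by rewrite inE xs orbT.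
  by rewrite -hk rh; exact: ik.
Qed.

End local_projection.

(** * Ultrafilter limits of bounded functions, and separation by the dual *)

Lemma ultra_bounded_cvg (R : realType) (T : Type) (U : set_system T)
    (f : T -> R) (M : R) :
  UltraFilter U -> (\forall t \near U, `|f t| <= M) -> cvg (f @ U).
Proof.
move=> UU fM; have [|p [_ clp]] := @segment_compact R (- M) M (f @ U) _.
  by apply: filterS fM => t; rewrite /= in_itv /= ler_norml.
apply/cvg_ex; exists p => A Ap.
(* A cluster point of an ultrafilter is its limit: otherwise the complement of a neighbourhood would
   belong to it, against clustering. *)
have [//|UnA] := in_ultra_setVsetC (f @^-1` A) UU.
by have [x [nAx Ax]] := clp (~` A) A UnA Ap; case: nAx.
Qed.

Section dual_separation.
Context {R : realType} {V : normedModType R}.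
Implicit Types (x y : V).

Lemma norming_dual x : exists2 f : V -> R^o, dual f &
  f x = `|x| /\ forall y, `|f y| <= `|y|.
Proof.
have [f [flin fle fx]] := norming_functional x.
have [g gf] := linear_ofP flin; exists f; last by [].
split=> //; rewrite -(funext gf).
by apply/linear_continuousP; exists 1 => // y; rewrite mul1r gf.
Qed.

Lemma dual_separates x y : (forall f, dual f -> f x = f y) -> x = y.
Proof.
move=> xy; apply/eqP; rewrite -subr_eq0 -normr_eq0.
have [f fd [<- _]] := norming_dual (x - y).
have [flin _] := fd; have [g gf] := linear_ofP flin.
by rewrite -gf linearB !gf (xy _ fd) subrr.
Qed.

Lemma le_dual_opnorm (f : V -> R^o) x : dual f -> `|f x| <= opnorm f * `|x|.
Proof.
move=> [flin fcont]; have [g gf] := linear_ofP flin.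
by move: fcont; rewrite -(funext gf); exact: le_opnorm.
Qed.

End dual_separation.

(** * The weak limit of local extensions *)

Section weak_limit.
Context {R : realType} {E Z : completeNormedModType R} (j : {linear E -> Z}).
Context (U : set_system (Z -> E)) {UU : UltraFilter U}.
Context (Uj : forall s t e, 0 < e -> U (local_projections j s t e)).

Let U_lin a x y : \forall T \near U, T (a *: x + y) = a *: T x + T y.
Proof.
apply: filterS (Uj [::] [:: x; y] ltr01) => T [Tlin _ _].
by apply: Tlin; rewrite !inE eqxx ?orbT.
Qed.

Let U_le e z : 0 < e -> \forall T \near U, `|T z| <= (1 + e) * `|z|.
Proof.
move=> e0; apply: filterS (Uj [::] [:: z] e0) => T [_ Tle _].
by apply: Tle; rewrite inE.
Qed.

Let U_id x : \forall T \near U, T (j x) = x.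
Proof.
apply: filterS (Uj [:: x] [::] ltr01) => T [_ _ Tid].
by apply: Tid; rewrite inE.
Qed.

Let U_dual_le (f : E -> R^o) e z : dual f -> 0 < e ->
  \forall T \near U, `|f (T z) : R| <= opnorm f * ((1 + e) * `|z|).
Proof.
move=> fd e0; apply: filterS (U_le z e0) => T Tz.
apply: le_trans (le_dual_opnorm _ fd) _; rewrite ler_wpM2l//.
have [flin fcont] := fd; have [g gf] := linear_ofP flin.
by move: fcont; rewrite -(funext gf); exact: opnorm_ge0.
Qed.

Let U_cvg (f : E -> R^o) z : dual f -> cvg ((fun T => f (T z) : R) @ U).
Proof. by move=> fd; exact: ultra_bounded_cvg (U_dual_le z fd ltr01). Qed.

Lemma weak_limit_projection : reflexive_space E -> exists P : {linear Z -> E},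
  (forall z, `|P z| <= `|z|) /\ forall x, P (j x) = x.
Proof.
move=> Erefl.
pose Phi z (f : E -> R^o) : R := lim ((fun T => f (T z) : R) @ U).
have PhiE z f : dual f -> (fun T => f (T z) : R) @ U --> Phi z f.
  exact: U_cvg.
(* For fixed [z], the limit [Phi z] is a bounded linear functional on the dual, so reflexivity
   represents it by a vector. *)
have /choice[P PE] z : exists x, forall f, dual f -> Phi z f = f x.
  apply: Erefl => [a f g fd gd|].
    apply/cvg_lim => //; apply: cvgD; last exact: PhiE.
    by apply: cvgMl_tmp; exact: PhiE.
  (* The factor 2 is [1 + e] at [e = 1]. *)
  exists (`|z| * 2) => f fd.
  apply: (cvgr_to_le (cvg_norm (PhiE z f fd))).
  by apply: filterS (U_dual_le z fd ltr01) => T /le_trans; apply; lra.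
have Plin : linear P.
  move=> a x y; apply: dual_separates => f fd.
  have [flin _] := fd; rewrite flin -!PE//.
  apply/cvg_lim => //.
  have : (fun T => a * (f (T x) : R) + (f (T y) : R)) @ U -->
      a * Phi x f + Phi y f.
    by apply: cvgD; [apply: cvgMl_tmp|]; exact: PhiE.
  apply: cvg_trans; apply: near_eq_cvg.
  by apply: filterS (U_lin a x y) => T ->; rewrite flin.
have [Q QP] := linear_ofP Plin; exists Q; split=> [z|x]; rewrite QP.
  have [f fd [fPz fle]] := norming_dual (P z).
  rewrite -fPz -PE//; apply/ler_addgt0Pr => d d0.
  (* This choice gives [e * |z| <= d], and the added 1 covers [z = 0]. *)
  pose e := d / (`|z| + 1).
  have z1 : 0 < `|z| + 1 by rewrite ltr_wpDl.
  have e0 : 0 < e by rewrite divr_gt0.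
  apply: (cvgr_to_le (PhiE z f fd)).
  apply: filterS (U_le z e0) => T Tz.
  apply: le_trans (ler_norm _) _; apply: le_trans (fle _) _.
  apply: le_trans Tz _; rewrite mulrDl mul1r lerD2l.
  by rewrite /e mulrAC ler_pdivrMr// ler_wpM2l ?ltW// ltrDl.
apply: dual_separates => f fd; rewrite -PE//.
apply: lim_near_cst => //.
by apply: filterS (U_id x) => T ->.
Qed.

End weak_limit.

(** * From local extensions to a norm one projection *)

Section complemented.
Context {R : realType} {E Z : completeNormedModType R} (j : {linear E -> Z}).

Lemma local_projections_sub (s s' : seq E) (t t' : seq Z) (e e' : R) :
  {subset s <= s'} -> {subset t <= t'} -> e' <= e ->
  local_projections j s' t' e' `<=` local_projections j s t e.
Proof.
move=> ss tt ee T [Tlin Tle Tid]; split=> [a x y /tt xt /tt yt|z /tt zt|x /ss].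
- exact: Tlin.
- by apply: le_trans (Tle _ zt) _; rewrite ler_wpM2r ?lerD2l.
- exact: Tid.
Qed.

(** Concatenating lists and taking the smaller tolerance bounds an intersection from below, so the
    sets of local extensions form a filter base; an ultrafilter refining it has the required weak
    limit. *)
Lemma local_projections_complemented : isometric j -> reflexive_space E ->
  (forall s t e, 0 < e -> local_projections j s t e !=set0) ->
  exists P : {linear Z -> E}, (forall z, `|P z| <= `|z|) /\
    forall x, P (j x) = x.
Proof.
move=> ji Erefl jne.
pose F := filter_from [set i : seq E * seq Z * R | 0 < i.2]
  (fun i => local_projections j i.1.1 i.1.2 i.2).
have FF : ProperFilter F.
  apply: filter_from_proper => [|i i0]; last exact: jne.
  apply: filter_from_filter; first by exists ([::], [::], 1) => /=.
  move=> [[s t] e] [[s' t'] e'] /= e0 e'0.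
  exists (s ++ s', t ++ t', Num.min e e') => /=; first by rewrite lt_min e0.
  move=> T jT; split; apply: local_projections_sub jT; rewrite ?ge_min ?lexx ?orbT//;
    by move=> x xs; rewrite mem_cat xs ?orbT.
have [U [UU FU]] := ultraFilterLemma FF.
apply: (@weak_limit_projection _ _ _ j U) => // s t e e0.
by apply: FU; exists (s, t, e).
Qed.

Lemma norm_one_complementedP (P : {linear Z -> E}) : isometric j ->
  (forall z, `|P z| <= `|z|) -> (forall x, P (j x) = x) ->
  norm_one_complemented j.
Proof.
move=> ji Ple Pj; have jPle z : `|j (P z)| <= 1 * `|z| by rewrite ji mul1r.
have cjP : continuous (j \o P : {linear Z -> Z}).
  by apply/linear_continuousP; exists 1.
exists (j \o P : {linear Z -> Z}); split=> //= [z||[x x0]].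
- by rewrite Pj.
- apply/seteqP; split=> _ [x _ <-]; first by exists (P x).
  by exists (j x) => //=; rewrite Pj.
apply/eqP; rewrite eq_le opnorm_le ?linear0//=.
(* The nonzero vector [j x] is fixed by the projection, which forces norm at least 1. *)
have nx : 0 < `|j x| by rewrite ji normr_gt0.
rewrite -(ler_pM2r nx) mul1r.
by rewrite -{1}(Pj x) (le_opnorm (f := j \o P : {linear Z -> Z})).
Qed.

End complemented.

Theorem corollary2 (R : realType) (X : completeNormedModType R)
  (hX : superreflexive (starstar X))
  (E : completeNormedModType R) (hE : starstar X E) (hEsep : separable E)
  (hEaud : almost_universal_disposition E (starstar_minkowski X))
  (Z : completeNormedModType R) (hZ : starstar X Z)
  (j : {linear E -> Z}) (hj : isometric j) :
  norm_one_complemented j.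
Proof.
(* The zero space is treated apart: the zero map inverts [j], while the local extensions require a
   nonzero vector of [E]. *)
have [Ene0|nE0] := pselect (exists x : E, x != 0); last first.
  have E0 (x : E) : x = 0.
    by apply: contrapT => /eqP x0; apply: nE0; exists x.
  apply: (@norm_one_complementedP _ _ _ _ (\0 : {linear Z -> E})) => // z.
  by rewrite normr0.
have [|P [Ple Pj]] := local_projections_complemented hj (hX _ hE).
  move=> s t e e0; apply: local_projections_nonempty hEaud Ene0 e0 => // A.
    exact: starstar_fd_subspaces.
  exact: starstar_fd_subspaces.
exact: norm_one_complementedP Ple Pj.
Qed.
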